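(* Fix $\varepsilon\in(0,1)$. For $\kappa>0$ let $a=(1-\varepsilon)\kappa$, $b=(1+\varepsilon)\kappa$, let $c^*=c^*(\kappa,\varepsilon)>0$ be the unique positive solution of $e^{-b^2/2}\cosh(bc^* )=e^{-a^2/2}\cosh(ac^* )$, and in the experiment $Y\sim N(\mu,1)$ let $$R_\infty(\phi)=\sup_{|\mu|\le a}E_\mu\phi(Y)+\sup_{|\mu|\ge b}E_\mu\{1-\phi(Y)\},\qquad R_\infty^*(\kappa,\varepsilon)=\inf_\phi R_\infty(\phi),\qquad S_\varepsilon(\kappa)=R_\infty(\mathbf 1\{|Y|>\kappa\}),$$ the infimum being over measurable $\phi:\mathbb R\to[0,1]$. Then, as $\kappa\to\infty$, $$\frac{c^*}{\kappa}\to1,\qquad R_\infty^*(\kappa,\varepsilon)\sim2\Phi(-\varepsilon\kappa),\qquad S_\varepsilon(\kappa)\sim R_\infty^*(\kappa,\varepsilon).$$ Hence the rule $\mathbf 1\{|Y|>\kappa\}$ is asymptotically minimax as $\kappa\to\infty$, in the sense that $S_\varepsilon(\kappa)/R_\infty^*(\kappa,\varepsilon)\to1$.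
   Context: $\Phi$ is the standard normal distribution function; $E_\mu$ is expectation under $Y\sim N(\mu,1)$; $f\sim g$ means $f/g\to1$. Existence and uniqueness of the positive solution $c^*$ hold for every $\kappa>0$ and $\varepsilon\in(0,1)$. *)

(* Defs.v *)
From mathcomp Require Import all_boot all_order all_algebra.
From mathcomp Require Import all_classical all_reals all_analysis.

Set Implicit Arguments.
Unset Strict Implicit.
Unset Printing Implicit Defensive.

Import Order.TTheory GRing.Theory Num.Theory.
Import numFieldNormedType.Exports.

Local Open Scope classical_set_scope.
Local Open Scope ring_scope.

Section Defs.
Variable R : realType.
Implicit Types (eps kappa a b c mu x : R) (phi : R -> R).

Definition cosh x : R := (expR x + expR (- x)) / 2.

Definition Phi x : R := fine (normal_prob 0 1 `]-oo, x]).

Definition lower_radius eps kappa : R := (1 - eps) * kappa.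

Definition upper_radius eps kappa : R := (1 + eps) * kappa.

Definition cstar_eq a b c : Prop :=
  expR (- b ^+ 2 / 2) * cosh (b * c) = expR (- a ^+ 2 / 2) * cosh (a * c).

(* Definite description: the value 0, which is not positive, is taken if and
   only if the positive solution fails to exist or to be unique. *)
Definition cstar kappa eps : R :=
  let a := lower_radius eps kappa in
  let b := upper_radius eps kappa in
  xget 0 [set c | unique (fun c => 0 < c /\ cstar_eq a b c) c].

Definition is_test phi : Prop :=
  measurable_fun [set: R] phi /\ forall y, 0 <= phi y <= 1.

Definition risk a b phi : \bar R :=
  (ereal_sup [set 'E_(normal_prob mu 1)[phi] | mu in [set mu | (`|mu| <= a)%R]]
   + ereal_sup [set 'E_(normal_prob mu 1)[fun y => (1 - phi y)%R]
                | mu in [set mu | (b <= `|mu|)%R]])%E.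

(* For tests the risk lies in [0, 2], so fine loses nothing below. *)
Definition minimax_risk kappa eps : R :=
  fine (ereal_inf [set risk (lower_radius eps kappa) (upper_radius eps kappa) phi
                  | phi in is_test]).

Definition threshold_rule kappa : R -> R := \1_[set y : R | kappa < `|y|].

Definition threshold_risk eps kappa : R :=
  fine (risk (lower_radius eps kappa) (upper_radius eps kappa)
             (threshold_rule kappa)).

Definition asymp_equiv_pinfty (f g : R -> R) : Prop :=
  f x / g x @[x --> +oo] --> (1 : R).

End Defs.

(* Main.v *)
From HB Require Import structures.
Require Import Defs.
From mathcomp Require Import all_boot all_order all_algebra.
From mathcomp Require Import all_classical all_reals all_analysis.
From mathcomp Require Import measurable_realfun ring lra.
Import Order.TTheory GRing.Theory Num.Theory.
Import numFieldNormedType.Exports.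
Local Open Scope classical_set_scope.
Local Open Scope ring_scope.

(* Testing the two points [a] and [b] against each other already costs
   [2 Phi (- (b - a) / 2) = 2 Phi (- eps kappa)], by Neyman-Pearson.  The rule
   [1{|Y| > kappa}] has risk at most [2 Phi (- eps kappa) + Phi (- kappa)], and
   the excess [Phi (- kappa)] is at most
   [exp (- ((1 - eps) kappa)^2 / 2) Phi (- eps kappa)].  So the minimax risk
   and the risk of the rule are both [2 Phi (- eps kappa) (1 + o(1))], with no
   need for the exact minimax test.  For [c*], the bounds
   [exp x / 2 <= cosh x <= exp x] for [x >= 0] locate the solution within
   [1 / (2 eps kappa)] of [kappa]. *)

(** * Translation and reflection of Lebesgue integrals *)

Lemma lebesgue_measure_shift (R : realType) (c : R) (A : set R) :
  measurable A ->
  pushforward lebesgue_measure ((fun x => x + c) : _ -> measurableTypeR R) A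
    = lebesgue_measure A.
Proof.
move=> mA.
have mc : measurable_fun [set: measurableTypeR R]
    ((fun x => x + c) : _ -> measurableTypeR R).
  exact: measurable_funD.
(* Bundling the shift as a measurable function makes its pushforward a measure; agreement with
   length on the intervals []a, b]] then identifies it as Lebesgue measure. *)
pose F : {mfun measurableTypeR R >-> measurableTypeR R} :=
  HB.pack ((fun x => x + c) : measurableTypeR R -> measurableTypeR R)
    (isMeasurableFun.Build _ _ _ _ _ mc).
apply/esym/(@lebesgue_measure_unique R (pushforward (@lebesgue_measure R) F)) => //=.
move=> _ [[a b]] _ <-.
rewrite /pushforward /=.
have -> : (fun x => x + c) @^-1` [set` `]a, b]] = [set` `](a - c), (b - c)]].
  by apply/seteqP; split=> x /=; rewrite !in_itv/= ltrBlDr lerBrDr.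
rewrite !lebesgue_measure_itv/= !lte_fin ltrD2r -!EFinB.
by case: ifP => // _; congr EFin; ring.
Qed.

Lemma ge0_integral_shift (R : realType) (c : R) (A : set R) (f : R -> \bar R) :
  measurable A -> measurable_fun [set: R] f -> (forall x, 0 <= f x)%E ->
  (\int[lebesgue_measure]_(x in A) f x =
   \int[lebesgue_measure]_(x in (fun x => x + c)%R @^-1` A) f (x + c)%R)%E.
Proof.
move=> mA mf f0.
have mc : measurable_fun [set: measurableTypeR R]
    ((fun x => x + c) : _ -> measurableTypeR R).
  exact: measurable_funD.
rewrite -[RHS](@ge0_integral_pushforward _ _ _ _ _ _ mc)//; last first.
  exact: measurable_funS mf.
by apply: eq_measure_integral => //= B mB BS; exact/esym/lebesgue_measure_shift.
Qed.

Lemma ge0_integral_oppr (R : realType) (A : set R) (f : R -> \bar R) :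
  measurable A -> measurable_fun [set: R] f -> (forall x, 0 <= f x)%E ->
  (\int[lebesgue_measure]_(x in A) f x =
   \int[lebesgue_measure]_(x in -%R @^-1` A) f (- x)%R)%E.
Proof.
move=> mA mf f0.
have mc : measurable_fun [set: measurableTypeR R]
    (-%R : _ -> measurableTypeR R) by [].
rewrite -[RHS](@ge0_integral_pushforward _ _ _ _ _ _ mc)//; last first.
  exact: measurable_funS mf.
by apply: eq_measure_integral => //= B mB BS; exact/esym/lebesgue_measureN.
Qed.

(** * Gaussian half-lines, likelihood comparison and tails *)

Section normal.
Variable R : realType.
Implicit Types (m x y : R) (A : set R).

Lemma measurable_EFin_normal_pdf m s A :
  measurable_fun A (fun x => (normal_pdf m s x)%:E).
Proof.
apply/measurable_EFinP; apply: (@measurable_funS _ _ _ _ setT) => //.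
exact: measurable_normal_pdf.
Qed.

Lemma normal_prob_shift m s A : s != 0 -> measurable A ->
  normal_prob m s A = normal_prob 0 s ((fun x => x + m) @^-1` A).
Proof.
move=> s0 mA; rewrite /normal_prob (@ge0_integral_shift _ m)//.
- by apply: eq_integral => x _; rewrite !normal_pdfE// /normal_fun addrK subr0.
- exact: measurable_EFin_normal_pdf.
- by move=> x; rewrite lee_fin normal_pdf_ge0.
Qed.

Lemma normal_prob_oppr m s A : s != 0 -> measurable A ->
  normal_prob m s A = normal_prob (- m) s (-%R @^-1` A).
Proof.
move=> s0 mA; rewrite /normal_prob ge0_integral_oppr//.
- apply: eq_integral => x _; rewrite !normal_pdfE// /normal_fun.
  by rewrite opprK -opprD sqrrN.
- exact: measurable_EFin_normal_pdf.
- by move=> x; rewrite lee_fin normal_pdf_ge0.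
Qed.

Lemma normal_prob_itvNyc m x : normal_prob m 1 `]-oo, x] = (Phi (x - m))%:E.
Proof.
rewrite normal_prob_shift ?oner_eq0//.
have -> : (fun y => y + m) @^-1` `]-oo, x] = [set` `]-oo, (x - m)]].
  by apply/seteqP; split=> y /=; rewrite !in_itv/= lerBrDr.
by rewrite /Phi fineK// fin_num_measure.
Qed.

Lemma normal_prob_itvcy m x : normal_prob m 1 `[x, +oo[ = (Phi (m - x))%:E.
Proof.
rewrite normal_prob_oppr ?oner_eq0// opp_preimage_itvbndy/=.
by rewrite normal_prob_itvNyc opprK addrC.
Qed.

Lemma normal_prob_itvoy m x : normal_prob m 1 `]x, +oo[ = (Phi (m - x))%:E.
Proof.
rewrite -normal_prob_itvcy /normal_prob integral_itv_obnd_cbnd//.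
exact: measurable_EFin_normal_pdf.
Qed.

Lemma Phi_ge0 x : 0 <= Phi x.
Proof. by rewrite /Phi fine_ge0. Qed.

Lemma Phi_le : {homo (@Phi R) : x y / x <= y}.
Proof.
move=> x y xy; rewrite -lee_fin -[x]subr0 -[y]subr0 -!normal_prob_itvNyc.
apply: le_measure; rewrite ?inE//.
by move=> z /=; rewrite !in_itv/= => /le_trans; exact.
Qed.

Lemma normal_pdf_homo (m1 m2 y : R) :
  (y - m2) ^+ 2 <= (y - m1) ^+ 2 -> normal_pdf m1 1 y <= normal_pdf m2 1 y.
Proof.
move=> h; rewrite !normal_pdfE ?oner_eq0// ler_wpM2l ?normal_peak_ge0//.
by rewrite /normal_fun ler_expR expr1n !mulNr lerN2 ler_wpM2r.
Qed.

(** With equal variances, the mean nearer to [y] gives the larger density there. This supplies the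
    domination hypotheses of [neyman_pearson]. *)
Lemma normal_prob_homo (m1 m2 : R) A : measurable A ->
  (forall y, A y -> (y - m2) ^+ 2 <= (y - m1) ^+ 2) ->
  (normal_prob m1 1 A <= normal_prob m2 1 A)%E.
Proof.
move=> mA h; apply: ge0_le_integral => //.
- by move=> y _; rewrite lee_fin normal_pdf_ge0.
- exact: measurable_EFin_normal_pdf.
- exact: measurable_EFin_normal_pdf.
- by move=> y Ay; rewrite lee_fin normal_pdf_homo// h.
Qed.

Lemma Phi_gt0 x : 0 < Phi x.
Proof.
rewrite -lte_fin -[x]subr0 -normal_prob_itvNyc.
(* A lower bound for the standard density on [[x - 1, x]], where the absolute value is at most
   [|x| + 1]. *)
pose c := normal_peak 1 * expR (- (`|x| + 1) ^+ 2 / 2) : R.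
have c0 : 0 < c by rewrite mulr_gt0 ?expR_gt0// normal_peak_gt0 ?oner_eq0.
apply: (@lt_le_trans _ _ (\int[lebesgue_measure]_(y in `[(x - 1)%R, x]) c%:E)%E).
  rewrite integral_cst//= lebesgue_measure_itv/= lte_fin ltrBlDr ltrDl ltr01.
  by rewrite -EFinB mule_gt0// lte_fin; lra.
apply: (@le_trans _ _ (normal_prob (0:R) 1 `[x - 1, x])); last first.
  apply: le_measure; rewrite ?inE//.
  by move=> z /=; rewrite !in_itv/= => /andP[].
apply: ge0_le_integral => //.
- by move=> y _; rewrite lee_fin ltW.
- exact: measurable_EFin_normal_pdf.
move=> y /=; rewrite in_itv/= => /andP[y1 y2].
rewrite lee_fin normal_pdfE ?oner_eq0// ler_wpM2l ?normal_peak_ge0//.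
rewrite /normal_fun ler_expR expr1n subr0 !mulNr lerN2 ler_wpM2r//.
have xn := ler_norm x; have nx := ler_norm (- x); rewrite normrN in nx.
by rewrite -subr_ge0 subr_sqr mulr_ge0//; lra.
Qed.

(** The left side is the mass that N(d,1) gives to []-oo, x]]. For [y <= x <= 0] the cross term in
    [(y - d)^2] is nonnegative, so [(y - d)^2 >= y^2 + d^2] and the densities compare pointwise. *)
Lemma Phi_tail x d : x <= 0 -> 0 <= d ->
  Phi (x - d) <= expR (- (d ^+ 2 / 2)) * Phi x.
Proof.
move=> x0 d0; rewrite -lee_fin EFinM -normal_prob_itvNyc.
rewrite -[in X in (_ <= _ * X)%E](subr0 x) -normal_prob_itvNyc.
rewrite /normal_prob -ge0_integralZl//; last 2 first.
- exact: measurable_EFin_normal_pdf.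
- by move=> y _; rewrite lee_fin normal_pdf_ge0.
apply: ge0_le_integral => //.
- by move=> y _; rewrite lee_fin normal_pdf_ge0.
- exact: measurable_EFin_normal_pdf.
- apply/measurable_EFinP/measurable_funM => //.
  apply: (@measurable_funS _ _ _ _ setT) => //; exact: measurable_normal_pdf.
move=> y /=; rewrite in_itv/= => yx; rewrite -EFinM lee_fin.
rewrite !normal_pdfE ?oner_eq0// mulrCA.
rewrite ler_wpM2l ?normal_peak_ge0// /normal_fun -expRD ler_expR expr1n subr0.
nra.
Qed.

End normal.

(** * A lower bound for testing two simple hypotheses *)

(* Splitting along the region where [P] is dominated by [Q], each piece of
   [E_P phi + E_Q (1 - phi)] is bounded below by the smaller measure. *)
Lemma neyman_pearson (d : measure_display) (T : measurableType d) (R : realType)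
    (P Q : probability T R) (H : set T) (phi : T -> R) :
  measurable H -> measurable_fun [set: T] phi ->
  (forall y, 0 <= phi y <= 1) ->
  (forall A, measurable A -> A `<=` H -> P A <= Q A)%E ->
  (forall A, measurable A -> A `<=` ~` H -> Q A <= P A)%E ->
  (P H + Q (~` H) <= 'E_P[phi] + 'E_Q[fun y => (1 - phi y)%R])%E.
Proof.
move=> mH mphi phi01 PQ QP.
have mN : measurable (~` H) by exact: measurableC.
have phi0 y : 0 <= phi y by have /andP[] := phi01 y.
have phi1 y : 0 <= 1 - phi y by rewrite subr_ge0; have /andP[] := phi01 y.
have mphi' : measurable_fun [set: T] (fun y => 1 - phi y).
  by apply: measurable_funB.
have split_integral (M : probability T R) (f : T -> R) : measurable_fun [set: T] f ->
    (forall y, 0 <= f y) ->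
    (\int[M]_y (f y)%:E = \int[M]_(y in H) (f y)%:E + \int[M]_(y in ~` H) (f y)%:E)%E.
  move=> mf f0; rewrite -ge0_integral_setU//= ?setUv//.
  - exact/measurable_EFinP.
  - by move=> y _; rewrite lee_fin.
  - exact/disj_setPCl.
have le_measure_restr (M N : probability T R) (D : set T) (f : T -> R) :
    measurable D -> (forall A, measurable A -> A `<=` D -> M A <= N A)%E ->
    measurable_fun [set: T] f -> (forall y, 0 <= f y) ->
    (\int[M]_(y in D) (f y)%:E <= \int[N]_(y in D) (f y)%:E)%E.
  move=> mD MN mf f0.
  (* Restricting both measures to [D] turns domination on subsets of [D] into domination on all
     measurable sets. *)
  rewrite (eq_measure_integral (mrestr M mD)); last first.
    by move=> A mA AD; rewrite /= /mrestr setIidl.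
  rewrite [leRHS](eq_measure_integral (mrestr N mD)); last first.
    by move=> A mA AD; rewrite /= /mrestr setIidl.
  apply: ge0_le_measure_integral => //.
  - by move=> A mA; apply: MN; [exact: measurableI|exact: subIsetr].
  - exact/measurable_EFinP.
have mass (M : probability T R) (D : set T) : measurable D ->
    (\int[M]_(y in D) (phi y)%:E + \int[M]_(y in D) (1 - phi y)%:E = M D)%E.
  move=> mD; rewrite -ge0_integralD//.
  - under eq_integral do rewrite -EFinD addrC subrK.
    by rewrite integral_cst// mul1e.
  - by move=> y _; rewrite lee_fin.
  - by apply/measurable_EFinP/measurable_funTS.
  - by move=> y _; rewrite lee_fin.
  - by apply/measurable_EFinP/measurable_funTS.
rewrite unlock (split_integral P phi)// (split_integral Q _ mphi')//.
rewrite addeACA -mass// -(mass Q)//.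
apply: leeD; apply: leeD => //; exact: le_measure_restr.
Qed.

(** * Lower bound for every test, upper bound for the threshold rule *)

Section risk.
Variable R : realType.
Implicit Types (a b kappa eps mu : R) (phi : R -> R).

Lemma risk_ge a b phi : 0 <= a -> a <= b -> is_test phi ->
  ((2 * Phi (- ((b - a) / 2)))%:E <= risk a b phi)%E.
Proof.
move=> a0 ab [mphi phi01].
(* The densities with means [a] and [b] cross at the midpoint [m], so [H] is the likelihood-ratio
   rejection region. *)
pose m := (a + b) / 2; pose H := `]m, +oo[%classic : set R.
have HC : ~` H = `]-oo, m]%classic.
  by rewrite setCitvr.
have NP : (normal_prob a 1 H + normal_prob b 1 (~` H) <=
    'E_(normal_prob a 1)[phi] + 'E_(normal_prob b 1)[fun y => (1 - phi y)%R])%E.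
  apply: (@neyman_pearson _ _ R (normal_prob a 1) (normal_prob b 1)) => //.
  - exact: measurable_itv.
  - move=> A mA AH; apply: normal_prob_homo => // y /AH.
    by rewrite /H /= in_itv/= andbT /m => my; nra.
  - rewrite HC => A mA AH; apply: normal_prob_homo => // y /AH /=.
    by rewrite in_itv/= /m => my; nra.
move: NP; rewrite HC /H normal_prob_itvoy normal_prob_itvNyc.
have -> : a - m = - ((b - a) / 2) by rewrite /m; lra.
have -> : m - b = - ((b - a) / 2) by rewrite /m; lra.
rewrite -EFinD => NP; rewrite [2 * _]mulr_natl mulr2n; apply: le_trans NP _.
apply: leeD; apply: ereal_sup_ubound.
- by exists a => //=; rewrite ger0_norm.
- by exists b => //=; rewrite ger0_norm// (le_trans a0).
Qed.

Lemma measurable_threshold kappa : measurable [set y : R | kappa < `|y|].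
Proof.
have -> : [set y : R | kappa < `|y|] = `]kappa, +oo[ `|` `]-oo, - kappa[.
  apply/seteqP; split=> y /=; rewrite !in_itv/= andbT ltr_normr ltrNr.
    by move/orP.
  by move/orP.
exact: measurableU.
Qed.

Lemma threshold_rule_test kappa : is_test (threshold_rule kappa).
Proof.
split; first by apply: measurable_indic; exact: measurable_threshold.
by move=> y; rewrite /threshold_rule indicE; case: (_ \in _); rewrite ?lexx ?ler01.
Qed.

(** The tail on the side of [mu] contributes at most [Phi (a - kappa)], and the opposite tail at
    most [Phi (- kappa)]; the sign of [mu] decides which is which. *)
Lemma type1_threshold_le kappa a mu : 0 <= kappa -> `|mu| <= a ->
  ('E_(normal_prob mu 1)[threshold_rule kappa]
    <= (Phi (a - kappa) + Phi (- kappa))%:E)%E.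
Proof.
move=> k0 mua; rewrite expectation_indic; last exact: measurable_threshold.
apply: (@le_trans _ _ (normal_prob mu 1 (`[kappa, +oo[ `|` `]-oo, - kappa]))).
  apply: le_measure; rewrite ?inE//.
  - exact: measurable_threshold.
  - exact: measurableU.
  move=> y /=; rewrite !in_itv/= andbT ltr_normr => /orP[] h; [left|right]; lra.
apply: (@le_trans _ _ (normal_prob mu 1 `[kappa, +oo[
                       + normal_prob mu 1 `]-oo, (- kappa)%R])%E).
  exact: measureU2.
rewrite normal_prob_itvcy normal_prob_itvNyc -EFinD lee_fin.
move: mua; rewrite ler_norml => /andP[mu1 mu2].
have [m0|m0] := leP 0 mu.
  by apply: lerD; apply: Phi_le; lra.
by rewrite addrC; apply: lerD; apply: Phi_le; lra.
Qed.

(** The acceptance interval lies in a half-line bounded only on the side of [mu], and the mass of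
    that half-line decreases as [|mu|] grows. *)
Lemma type2_threshold_le kappa b mu : b <= `|mu| ->
  ('E_(normal_prob mu 1)[fun y => (1 - threshold_rule kappa y)%R]
    <= (Phi (kappa - b))%:E)%E.
Proof.
move=> bmu; set A := [set y : R | kappa < `|y|].
have mA : measurable (~` A) by apply: measurableC; exact: measurable_threshold.
have -> : (fun y => 1 - threshold_rule kappa y) = \1_(~` A).
  by apply/funext => y; rewrite /threshold_rule !indicE in_setC -/A;
     case: (y \in A); rewrite ?subrr ?subr0.
rewrite expectation_indic//.
move: bmu; rewrite ler_normr => /orP[bmu|bmu].
- apply: (@le_trans _ _ (normal_prob mu 1 `]-oo, kappa])).
    apply: le_measure; rewrite ?inE// => y /= /negP; rewrite -leNgt in_itv/=.
    by rewrite ler_norml => /andP[].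
  by rewrite normal_prob_itvNyc lee_fin Phi_le// lerB.
- apply: (@le_trans _ _ (normal_prob mu 1 `[- kappa, +oo[)).
    apply: le_measure; rewrite ?inE// => y /= /negP; rewrite -leNgt in_itv/=.
    by rewrite ler_norml => /andP[-> _].
  by rewrite normal_prob_itvcy lee_fin Phi_le//; lra.
Qed.

Lemma risk_threshold_le a b kappa : 0 <= kappa ->
  (risk a b (threshold_rule kappa) <=
   (Phi (a - kappa) + Phi (- kappa) + Phi (kappa - b))%:E)%E.
Proof.
move=> k0; rewrite EFinD; apply: leeD; apply: ge_ereal_sup => _ [mu /= hmu <-].
- exact: type1_threshold_le.
- exact: type2_threshold_le.
Qed.

Lemma minimax_threshold_sandwich eps kappa : 0 < eps < 1 -> 0 <= kappa ->
  [/\ 2 * Phi (- (eps * kappa)) <= minimax_risk kappa eps,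
      minimax_risk kappa eps <= threshold_risk eps kappa &
      threshold_risk eps kappa <=
        2 * Phi (- (eps * kappa)) * (1 + expR (- (((1 - eps) * kappa) ^+ 2 / 2)))].
Proof.
move=> /andP[e0 e1] k0.
set a := lower_radius eps kappa; set b := upper_radius eps kappa.
have a0 : 0 <= a by rewrite mulr_ge0// subr_ge0 ltW.
have ab : a <= b by rewrite ler_wpM2r//; lra.
have baE : (b - a) / 2 = eps * kappa by rewrite /b /a /upper_radius /lower_radius; lra.
set r := risk a b (threshold_rule kappa).
set i := ereal_inf [set risk a b phi | phi in @is_test R].
have Li : ((2 * Phi (- (eps * kappa)))%:E <= i)%E.
  apply: le_ereal_inf_tmp => _ [phi tphi <-].
  by rewrite -baE; exact: risk_ge.
have ir : (i <= r)%E.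
  apply: ereal_inf_lbound; exists (threshold_rule kappa) => //.
  exact: threshold_rule_test.
have rU : (r <= (2 * Phi (- (eps * kappa)) *
    (1 + expR (- (((1 - eps) * kappa) ^+ 2 / 2))))%:E)%E.
  apply: le_trans (risk_threshold_le _ _ _ k0) _.
  have -> : a - kappa = - (eps * kappa) by rewrite /a /lower_radius; lra.
  have -> : kappa - b = - (eps * kappa) by rewrite /b /upper_radius; lra.
  have tail : Phi (- kappa) <=
      expR (- (((1 - eps) * kappa) ^+ 2 / 2)) * Phi (- (eps * kappa)).
    have -> : - kappa = - (eps * kappa) - (1 - eps) * kappa by lra.
    by apply: Phi_tail => //; rewrite oppr_le0 mulr_ge0// ltW.
  have := mulr_ge0 (expR_ge0 (- (((1 - eps) * kappa) ^+ 2 / 2)))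
    (@Phi_ge0 R (- (eps * kappa))).
  rewrite lee_fin; lra.
(* Finiteness lets the extended-real inequalities pass through [fine]. *)
have fr : r \is a fin_num.
  by rewrite fin_numElt (lt_le_trans (ltNyr _) (le_trans Li ir)) (le_lt_trans rU (ltry _)).
have fi : i \is a fin_num.
  by rewrite fin_numElt (lt_le_trans (ltNyr _) Li) (le_lt_trans (le_trans ir rU) (ltry _)).
by rewrite /minimax_risk /threshold_risk -/a -/b -/r -/i -!lee_fin !fineK.
Qed.

End risk.

(** * Existence, uniqueness and location of [cstar] *)

Section cstar.
Variable R : realType.
Implicit Types (a b c x y kappa eps : R).

Lemma coshD_coshB x y : cosh (x + y) + cosh (x - y) = 2 * (cosh x * cosh y).
Proof.
by rewrite /cosh !opprD !opprK !expRD; field.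
Qed.

(** With [q = exp (- (x + y))], twice the difference [cosh y - cosh x] factors as
    [(exp y - exp x) (1 - q)]. *)
Lemma ltr_cosh x y : `|x| < y -> cosh x < cosh y.
Proof.
rewrite ltr_norml => /andP[yx xy].
have e1 : expR x < expR y by rewrite ltr_expR.
have e2 : expR (- (x + y)) < 1 by rewrite expR_lt1; lra.
have e3 : expR (- x) = expR y * expR (- (x + y)).
  by rewrite -expRD; congr expR; ring.
have e4 : expR (- y) = expR x * expR (- (x + y)).
  by rewrite -expRD; congr expR; ring.
by rewrite /cosh ltr_pM2r// e3 e4; nra.
Qed.

Lemma cosh_ge x : expR x / 2 <= cosh x.
Proof. by rewrite /cosh ler_wpM2r// lerDl expR_ge0. Qed.

Lemma cosh_le x : 0 <= x -> cosh x <= expR x.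
Proof.
move=> x0; have : expR (- x) <= expR x by rewrite ler_expR; lra.
by rewrite /cosh; lra.
Qed.

(* Product-to-sum turns this into two comparisons of single values of [cosh]. *)
Lemma cosh_ratio_lt a b x y : 0 <= a -> a < b -> 0 <= x -> x < y ->
  cosh (b * x) * cosh (a * y) < cosh (b * y) * cosh (a * x).
Proof.
move=> a0 ab x0 xy; rewrite -(ltr_pM2l (ltr0n _ 2)) -!coshD_coshB.
apply: ltrD; apply: ltr_cosh; rewrite ltr_norml; apply/andP; split; nra.
Qed.

(** The equation prescribes the value of [cosh (b c) / cosh (a c)], which is strictly increasing for
    [c >= 0] by [cosh_ratio_lt], used here in cross-multiplied form. *)
Lemma cstar_eq_inj a b x y : 0 <= a -> a < b -> 0 < x -> 0 < y ->
  cstar_eq a b x -> cstar_eq a b y -> x = y.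
Proof.
move=> a0 ab.
wlog xy : x y / x < y.
  move=> th x0 y0 ex ey; have [xy|yx|//] := ltgtP x y; first exact: th.
  by apply/esym/th.
move=> x0 y0; rewrite /cstar_eq => ex ey.
have := @cosh_ratio_lt a b x y a0 ab (ltW x0) xy.
have A0 := expR_gt0 (- a ^+ 2 / 2); have B0 := expR_gt0 (- b ^+ 2 / 2).
rewrite -(ltr_pM2l A0) -(ltr_pM2l B0).
have -> : expR (- b ^+ 2 / 2) * (expR (- a ^+ 2 / 2) * (cosh (b * x) * cosh (a * y)))
  = (expR (- b ^+ 2 / 2) * cosh (b * x)) * (expR (- a ^+ 2 / 2) * cosh (a * y)) by ring.
have -> : expR (- b ^+ 2 / 2) * (expR (- a ^+ 2 / 2) * (cosh (b * y) * cosh (a * x)))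
  = (expR (- b ^+ 2 / 2) * cosh (b * y)) * (expR (- a ^+ 2 / 2) * cosh (a * x)) by ring.
by rewrite ex ey mulrC ltxx.
Qed.

Lemma continuous_cosh : continuous (@cosh R).
Proof.
move=> x; apply: cvgM; last exact: cvg_cst.
apply: cvgD; first exact: continuous_expR.
by apply: continuous_comp; [exact: opp_continuous|exact: continuous_expR].
Qed.

Lemma expR1D_ge x : 2 * expR x <= expR (1 + x).
Proof. by rewrite expRD ler_wpM2r ?expR_ge0// (le_trans _ (expR_ge1Dx 1)). Qed.

(* At distance [d] from the midpoint the two exponents differ by exactly 1, and
   [2 <= exp 1] absorbs the factor lost in [exp x / 2 <= cosh x]. *)
Lemma cstar_eq_sol a b d : 0 <= a -> a < b -> d = (b - a)^-1 ->
  d <= (a + b) / 2 ->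
  exists2 c, (a + b) / 2 - d <= c <= (a + b) / 2 + d & cstar_eq a b c.
Proof.
move=> a0 ab dE dm; set m := (a + b) / 2.
have d0 : 0 < d by rewrite dE invr_gt0 subr_gt0.
have bad : (b - a) * d = 1 by rewrite dE mulfV// subr_eq0 gt_eqF.
(* The exponents [b c - b^2 / 2] and [a c - a^2 / 2] coincide at [c = m], so [F] changes sign
   between [m - d] and [m + d]. *)
pose F c := expR (- b ^+ 2 / 2) * cosh (b * c) - expR (- a ^+ 2 / 2) * cosh (a * c).
have Fm : F (m - d) <= 0.
  rewrite /F subr_le0.
  have c0 : 0 <= m - d by rewrite subr_ge0.
  have b0 : 0 <= b by lra.
  have h1 := cosh_le _ (mulr_ge0 b0 c0); have h2 := cosh_ge (a * (m - d)).
  apply: (@le_trans _ _ (expR (- b ^+ 2 / 2) * expR (b * (m - d)))).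
    by rewrite ler_wpM2l ?expR_ge0.
  apply: (@le_trans _ _ (expR (- a ^+ 2 / 2) * (expR (a * (m - d)) / 2))); last first.
    by rewrite ler_wpM2l ?expR_ge0.
  rewrite mulrA -!expRD ler_pdivlMr// mulrC.
  apply: le_trans (expR1D_ge _) _; rewrite ler_expR /m; move: bad; lra.
have Fp : 0 <= F (m + d).
  rewrite /F subr_ge0.
  have c0 : 0 <= a * (m + d) by rewrite mulr_ge0// /m; lra.
  have h1 := cosh_le _ c0; have h2 := cosh_ge (b * (m + d)).
  apply: (@le_trans _ _ (expR (- a ^+ 2 / 2) * expR (a * (m + d)))).
    by rewrite ler_wpM2l ?expR_ge0.
  apply: (@le_trans _ _ (expR (- b ^+ 2 / 2) * (expR (b * (m + d)) / 2))); last first.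
    by rewrite ler_wpM2l ?expR_ge0.
  rewrite mulrA -!expRD ler_pdivlMr// mulrC.
  apply: le_trans (expR1D_ge _) _; rewrite ler_expR /m; move: bad; lra.
have cF : continuous F.
  have cc t s : continuous (fun c : R => s * cosh (t * c)).
    move=> c; apply: cvgM; first exact: cvg_cst.
    by apply: (continuous_comp (@mulrl_continuous _ t c)); exact: continuous_cosh.
  by move=> c; apply: cvgB; exact: cc.
have [|||c] := @IVT R F (m - d) (m + d) 0.
- by lra.
- exact: continuous_subspaceT.
- by rewrite ge_min Fm le_max Fp orbT.
rewrite in_itv/= => cI Fc; exists c => //.
by apply/eqP; rewrite -subr_eq0; apply/eqP.
Qed.

(** The midpoint of the two radii is [kappa] and their gap is [2 eps kappa]. The last hypothesis
    makes the bracket around [kappa] lie in the positive reals. *)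
Lemma cstar_dist eps kappa : 0 < eps < 1 -> 0 < kappa ->
  1 < 2 * eps * kappa ^+ 2 ->
  `|cstar kappa eps - kappa| <= (2 * eps * kappa)^-1.
Proof.
move=> /andP[e0 e1] k0 ek.
set a := lower_radius eps kappa; set b := upper_radius eps kappa.
have a0 : 0 <= a by rewrite mulr_ge0 ?ltW// subr_gt0.
have baE : b - a = 2 * eps * kappa by rewrite /b /a /upper_radius /lower_radius; ring.
have mE : (a + b) / 2 = kappa by rewrite /b /a /upper_radius /lower_radius; field.
have ab : a < b by rewrite -subr_gt0 baE !mulr_gt0.
have dlt : (2 * eps * kappa)^-1 < kappa.
  rewrite -[ltLHS]div1r ltr_pdivrMr ?mulr_gt0//.
  by have -> : kappa * (2 * eps * kappa) = 2 * eps * kappa ^+ 2 by ring.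
have [|c cI ec] := @cstar_eq_sol a b _ a0 ab erefl.
  by rewrite baE mE ltW.
rewrite baE mE in cI.
have c0 : 0 < c by case/andP: cI => c1 _; lra.
have uc : unique (fun c => 0 < c /\ cstar_eq a b c) c.
  by split=> // c' [c'0 ec']; apply: cstar_eq_inj ec ec'.
(* Since a unique positive solution exists, [xget] returns it rather than the default 0. *)
have [_ cE] : unique (fun c => 0 < c /\ cstar_eq a b c) (cstar kappa eps).
  exact: (@xgetPex _ 0 [set c | unique _ c] (ex_intro _ c uc)).
by rewrite (cE c)// ler_norml; lra.
Qed.

Lemma cvgy1_rate (f : R -> R) (C K : R) :
  (forall x, K <= x -> `|f x - 1| <= C / x) -> f x @[x --> +oo] --> (1 : R).
Proof.
move=> h; apply/cvgrPdist_lt => e e0; near=> x.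
have x0 : 0 < x by near: x; apply: nbhs_pinfty_gt; exact: num_real.
rewrite distrC; apply: le_lt_trans (h _ _) _.
  by near: x; apply: nbhs_pinfty_ge; exact: num_real.
rewrite ltr_pdivrMr// mulrC -ltr_pdivrMr//.
by near: x; apply: nbhs_pinfty_gt; exact: num_real.
Unshelve. all: by end_near.
Qed.

End cstar.

(** * Limits as [kappa] tends to infinity, from explicit rates *)

Theorem corollary2 (R : realType) (eps : R) (heps : 0 < eps < 1) :
  [/\ cstar kappa eps / kappa @[kappa --> +oo] --> (1 : R),
      asymp_equiv_pinfty (fun kappa : R => minimax_risk kappa eps)
                         (fun kappa : R => 2 * Phi (- (eps * kappa))),
      asymp_equiv_pinfty (fun kappa : R => threshold_risk eps kappa)
                         (fun kappa : R => minimax_risk kappa eps) &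
      threshold_risk eps kappa / minimax_risk kappa eps
        @[kappa --> +oo] --> (1 : R)].
Proof.
have /andP[e0 e1] := heps.
have d0 : 0 < 1 - eps by lra.
(* From [exp (- t) <= 1 / t] at [t = ((1 - eps) kappa)^2 / 2]: here [1 / t = C / kappa^2], which is
   at most [C / kappa] once [kappa >= 1]. *)
pose C := 2 / (1 - eps) ^+ 2.
have C0 : 0 < C by rewrite divr_gt0// exprn_gt0.
have delta_le kappa : 1 <= kappa ->
    expR (- (((1 - eps) * kappa) ^+ 2 / 2)) <= C / kappa.
  move=> k1; have k0 : 0 < kappa by lra.
  set t := _ ^+ 2 / 2.
  have t0 : 0 < t by rewrite divr_gt0// exprn_gt0// mulr_gt0.
  apply: (@le_trans _ _ t^-1).
    rewrite expRN lef_pV2 ?posrE ?expR_gt0//.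
    by apply: le_trans (expR_ge1Dx t); lra.
  have -> : t^-1 = C / kappa / kappa.
    by rewrite /t /C; field; rewrite ?gt_eqF//.
  by rewrite ler_pdivrMr// ler_peMr// divr_ge0// ltW.
have ratio_le (x y E : R) : 0 < y -> y <= x -> x <= y * (1 + E) ->
    `|x / y - 1| <= E.
  move=> y0 yx xE; rewrite ger0_norm; last by rewrite subr_ge0 ler_pdivlMr// mul1r.
  by rewrite lerBlDl ler_pdivrMr// mulrC.
have main kappa : 1 <= kappa ->
    `|minimax_risk kappa eps / (2 * Phi (- (eps * kappa))) - 1| <= C / kappa /\
    `|threshold_risk eps kappa / minimax_risk kappa eps - 1| <= C / kappa.
  move=> k1; have k0 : 0 <= kappa by lra.
  have [LM MS SU] := @minimax_threshold_sandwich R eps kappa heps k0.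
  have L0 : 0 < 2 * Phi (- (eps * kappa)) by rewrite mulr_gt0 ?Phi_gt0.
  have E0 := expR_ge0 (- (((1 - eps) * kappa) ^+ 2 / 2)).
  split; apply: le_trans (delta_le _ k1); apply: ratio_le => //.
  - exact: le_trans MS SU.
  - exact: lt_le_trans L0 LM.
  (* The minimax risk is at least [2 Phi (- eps kappa)], so it may replace that factor in the upper
     bound. *)
  - by apply: le_trans SU _; rewrite ler_wpM2r// addr_ge0.
have threshold_minimax : threshold_risk eps kappa / minimax_risk kappa eps
    @[kappa --> +oo] --> (1 : R).
  by apply: (@cvgy1_rate _ _ C 1) => kappa /main[].
split => //.
(* From [kappa >= 1 / eps] follow [kappa >= 1] and [eps kappa >= 1], hence the condition
   [1 < 2 eps kappa^2] of [cstar_dist]. *)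
- apply: (@cvgy1_rate _ _ (2 * eps)^-1 eps^-1) => kappa ke.
  have k1 : 1 <= kappa by apply: le_trans ke; rewrite invf_ge1// ltW.
  have k0 : 0 < kappa by lra.
  have ek : 1 <= eps * kappa by rewrite mulrC -ler_pdivrMr// div1r.
  have := @cstar_dist R eps kappa heps k0.
  have -> : cstar kappa eps / kappa - 1 = (cstar kappa eps - kappa) / kappa.
    by rewrite mulrBl divff// gt_eqF.
  rewrite normrM (ger0_norm (_ : 0 <= kappa^-1)) ?invr_ge0 ?(ltW k0)// => cd.
  rewrite ler_wpM2r ?invr_ge0 ?(ltW k0)//; apply: le_trans (cd _) _; first by nra.
  by rewrite lef_pV2 ?posrE ?mulr_gt0// ler_peMr// mulr_ge0// ltW.
- by apply: (@cvgy1_rate _ _ C 1) => kappa /main[].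
Qed.
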